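(* There is a positive absolute constant $k_4$ such that for every integer $c\ge 3$, written as $c=q_1^{a_1}\cdots q_\omega^{a_\omega}$ with $q_i$ distinct primes and $a_i\ge 1$, $$G_c^{2/\varphi(c)}>k_4\prod_{i=1}^{\omega} q_i^{\,2a_i-1-\frac{2}{\varphi(c)}E_c(q_i)}\left(\frac{q_i-1}{2}\right)^2.$$
   Context: For a positive integer $n$, $R(n)$ denotes the product of the distinct primes dividing $n$. $\varphi$ is Euler's totient function. For $c\ge3$, $G_c$ is the product of $R(abc)$ over all pairs of positive integers $(a,b)$ with $a+b=c$, $a<b$, $\gcd(a,b)=1$ (there are $\varphi(c)/2$ such pairs), so $G_c^{2/\varphi(c)}$ is the geometric mean of these radicals. For $c$ with distinct prime factors $q_1,\dots,q_\omega$ and real $x\ne0$, $E_c(x)=\sum_{S\subseteq\{1,\dots,\omega\}}(-1)^{|S|}\lfloor c/(x\prod_{j\in S}q_j)\rfloor$. *)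

(* Defs.v *)
From HB Require Import structures.
From mathcomp Require Import all_boot all_order all_algebra.
From mathcomp Require Import all_classical all_reals.
From mathcomp Require Import exp Rstruct.
From Stdlib Require Rdefinitions.
Notation R := Rdefinitions.R.
Set Implicit Arguments. Unset Strict Implicit. Unset Printing Implicit Defensive.
Import Order.TTheory GRing.Theory Num.Theory.
Local Open Scope ring_scope.

Definition rad (n : nat) : nat := (\prod_(p <- primes n) p)%N.

Definition Gc (c : nat) : nat :=
  (\prod_(1 <= a < c | ((a < c - a) && coprime a (c - a))%N) rad (a * (c - a) * c))%N.

Definition qc (c : nat) (j : nat) : nat := nth 0%N (primes c) j.

Definition Ec (c : nat) (x : R) : R :=
  \sum_(S : {set 'I_(size (primes c))})
     (-1) ^+ #|S| * (Num.floor (c%:R / (x * (\prod_(j in S) qc c j)%N%:R)))%:~R.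

(* Main.v *)
(* Each prime p not dividing c contributes p^(E_c(p)) to the product of the
   R(n) over n < c coprime to c, so taking logarithms the claim becomes
     sum_{p <= c} E_c(p) ln p >= phi(c) (ln phi(c) - omega ln 2 - O(1)),
   where the factors q^(- 2 E_c(q) / phi(c)) on the right-hand side supply the
   missing terms of the primes q dividing c.  Replacing each of the 2^omega
   floors in E_c(p) by its argument gives E_c(p) >= phi(c) / p - 2^omega.
   Keep only the primes p <= n = phi(c) / 2^omega: by Mertens the main terms
   give phi(c) (ln n - O(1)), and by Chebyshev the errors add up to
   2^omega * O(n) = O(phi(c)). *)
Require Import Defs.
From HB Require Import structures.
From mathcomp Require Import all_boot all_order all_algebra.
From mathcomp Require Import all_classical all_reals.
From mathcomp Require Import exp Rstruct.
From Stdlib Require Rdefinitions.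
From mathcomp Require Import sequences zify ring lra.
Import Order.TTheory GRing.Theory Num.Theory.
Local Open Scope ring_scope.

(** * Chebyshev's bound on the primorial *)

Lemma dvdn_prod_primes (s : seq nat) (m : nat) : uniq s -> all prime s ->
  (\prod_(p <- s) p %| m)%N = all (dvdn^~ m) s.
Proof.
elim: s => [|p s IHs] /=; first by rewrite big_nil dvd1n.
move=> /andP[ps us] /andP[pp prs]; rewrite big_cons Gauss_dvd ?IHs //.
rewrite big_seq; apply: (big_ind (coprime p)) => [|x y cx cy|q qs].
- exact: coprimen1.
- by rewrite coprimeMr cx.
- rewrite prime_coprime // dvdn_prime2 ?(allP prs q qs) //.
  by apply: contraNneq ps => ->.
Qed.

Lemma prime_dvd_fact (p n : nat) : prime p -> (p %| n`!)%N = (p <= n)%N.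
Proof.
move=> pp; apply/idP/idP => [|lepn]; last by rewrite dvdn_fact ?prime_gt0.
elim: n => [|n IHn]; first by rewrite fact0 dvdn1 => /eqP p1; rewrite p1 in pp.
rewrite factS Euclid_dvdM // => /orP[/dvdn_leq->//|/IHn]; exact: leqW.
Qed.

(** The binomial expansion of [2 ^ m.*2.+1] contains this coefficient twice, at the indices [m] and
    [m.+1]. *)
Lemma bin_middle_le (m : nat) : ('C(m.*2.+1, m) <= 4 ^ m)%N.
Proof.
have -> : (4 ^ m = 2 ^ m.*2)%N by rewrite -mul2n expnM.
rewrite -(leq_pmul2l (isT : (0 < 2)%N)) -expnS.
rewrite -[in leqRHS]addn1 expnDn (eq_bigr (fun i : 'I_ _ => 'C(m.*2.+1, i))); last first.
  by move=> i _; rewrite !exp1n !muln1.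
rewrite -(big_mkord xpredT (fun i => 'C(m.*2.+1, i))).
rewrite (big_cat_nat _ (n := m)) /=; [|lia..].
rewrite [X in (_ + X)%N]big_ltn; last by lia.
rewrite [X in (_ + (_ + X))%N]big_ltn; last by lia.
rewrite -(@bin_sub _ m.+1); last by lia.
have -> : (m.*2.+1 - m.+1 = m)%N by lia.
lia.
Qed.

(** Erdős's induction: an even number above 2 brings no new prime, and at [2m+1] the primes above
    [m+1] all divide ['C(2m+1, m)], which is at most [4 ^ m]. *)
Lemma primorial_le (n : nat) : (\prod_(1 <= p < n.+1 | prime p) p <= 4 ^ n)%N.
Proof.
have [k] := ubnP n; elim: k n => // k IHk [|n] lenk; first by rewrite big_geq.
(* The bounds 2 and 1 are treated apart: 2 is an even prime, and at 1 = 2m+1 the induction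
   hypothesis for [m+1] would not be smaller. *)
have [->|n1] := eqVneq n 1%N; first by rewrite unlock.
have [->|n0] := eqVneq n 0%N; first by rewrite unlock.
case: (boolP (odd n)) => on.
  rewrite big_mkcond big_nat_recr //= -big_mkcond /= ifN.
    rewrite muln1 (leq_trans (IHk n _)) ?leq_pexp2l //.
  apply/negP=> pn; have := odd_prime_gt2 _ pn => /=.
  have : (2 %| n.+1)%N by rewrite dvdn2 /= on.
  rewrite (dvdn_prime2 _ pn) // => /eqP; lia.
pose m := n./2; have nE : n = m.*2 by rewrite -[LHS]odd_double_half (negbTE on).
rewrite nE (big_cat_nat _ (n := m.+2)) /=; [|lia..].
have -> : (4 ^ m.*2.+1 = 4 ^ m.+1 * 4 ^ m)%N by rewrite -expnD; congr (_ ^ _)%N; lia.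
rewrite leq_mul //; first by apply: IHk; lia.
apply: leq_trans (bin_middle_le m).
apply: dvdn_leq; first by rewrite bin_gt0; lia.
rewrite -big_filter dvdn_prod_primes ?filter_uniq ?iota_uniq ?filter_all //.
apply/allP => p; rewrite mem_filter mem_index_iota => /and3P[pp mp pm].
have : (p %| m.*2.+1`!)%N by rewrite prime_dvd_fact.
(* [p] divides [(2m+1)!] but exceeds [m+1], so it divides neither [m!] nor [(m+1)!] and must divide
   the binomial coefficient. *)
rewrite -(@bin_fact _ m); last by lia.
rewrite !Euclid_dvdM // !prime_dvd_fact //.
have [-> ->] : (p <= m)%N = false /\ (p <= m.*2.+1 - m)%N = false by lia.
by rewrite !orbF.
Qed.

(** * Prime valuations of factorials *)

(** The extra summand [n %/ p ^ k] carries the induction: [p] copies of [n %/ p ^ k.+1] fit into it.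
    With Legendre's formula this bounds the valuation of [n!] by [n / (p - 1)]. *)
Lemma sum_divn_expn_le (p n k : nat) :
  (p.-1 * (\sum_(1 <= i < k.+1) n %/ p ^ i) + n %/ p ^ k <= n)%N.
Proof.
elim: k => [|k IHk]; first by rewrite big_geq // muln0 expn0 divn1.
rewrite big_nat_recr //=; apply: leq_trans IHk.
rewrite mulnDr -addnA leq_add2l expnSr divnMA.
case: p => [|p] /=; first by rewrite divn0 mul0n.
by rewrite addnC -mulSn mulnC leq_divM.
Qed.

Lemma logn_fact_le (p n : nat) : prime p -> (p.-1 * logn p n`! <= n)%N.
Proof.
move=> pp; rewrite logn_fact //.
exact: leq_trans (leq_addr _ _) (sum_divn_expn_le p n n).
Qed.

(** * [Ec] as a count of integers coprime to [c] *)

Lemma sum_nat_dvdn (F : nat -> nat) (p c : nat) : (0 < p)%N ->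
  (\sum_(1 <= n < c.+1 | p %| n) F n = \sum_(1 <= m < (c %/ p).+1) F (p * m)%N)%N.
Proof.
move=> p0; elim: c => [|c IHc]; first by rewrite div0n !big_geq.
rewrite big_mkcond big_nat_recr //= -big_mkcond /= IHc divnS //.
case: ifP => dv; last by rewrite addn0.
rewrite add1n [RHS]big_nat_recr //=; congr (_ + F _)%N.
by have := divnS c p0; rewrite dv add1n => <-; rewrite mulnC divnK.
Qed.

Lemma qc_prime (c : nat) (j : 'I_(size (primes c))) : prime (qc c j).
Proof. by have := mem_nth 0%N (ltn_ord j); rewrite mem_primes => /andP[]. Qed.

Lemma big_primes_qc (T : Type) (idx : T) (op : Monoid.com_law idx) (c : nat)
    (F : nat -> T) :
  \big[op/idx]_(q <- primes c) F q = \big[op/idx]_(j < size (primes c)) F (qc c j).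
Proof. by rewrite (big_nth 0%N) big_mkord. Qed.

Lemma dvdn_prod_qc (c m : nat) (S : {set 'I_(size (primes c))}) :
  (((\prod_(j in S) qc c j)%N %| m)%N%:R : R) = \prod_(j in S) (qc c j %| m)%N%:R.
Proof.
rewrite -big_enum -(big_map (fun j : 'I__ => qc c j) xpredT id) /=.
rewrite dvdn_prod_primes; last 2 first.
- rewrite map_inj_in_uniq ?enum_uniq // => i j _ _ /eqP.
  by rewrite /qc nth_uniq ?primes_uniq // => /eqP /val_inj.
- by apply/allP => _ /mapP[j _ ->]; exact: qc_prime.
rewrite -big_enum; elim: (enum S) => [|j s IHs] /=; first by rewrite big_nil.
by rewrite big_cons -IHs; case: (qc c j %| m)%N; rewrite ?mul1r ?mul0r.
Qed.

Lemma indicator_coprime (c m : nat) : (0 < c)%N -> (0 < m)%N ->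
  ((coprime m c)%:R : R) = \prod_(j < size (primes c)) (1 - (qc c j %| m)%N%:R).
Proof.
move=> c0 m0; rewrite -(big_primes_qc _ _ _ c (fun q => 1 - (q %| m)%N%:R)).
rewrite coprime_has_primes // -all_predC.
rewrite (eq_in_all (a2 := fun q => ~~ (q %| m)%N)); last first.
  by move=> q; rewrite mem_primes => /and3P[pq _ _] /=; rewrite mem_primes pq m0.
elim: (primes c) => [|q s IHs] /=; first by rewrite big_nil.
by rewrite big_cons -IHs; case: (q %| m)%N; rewrite /= ?subrr ?subr0 ?mul1r ?mul0r.
Qed.

Lemma floor_natr_div (n d : nat) : (0 < d)%N ->
  Num.floor (n%:R / d%:R : R) = (n %/ d)%N%:Z.
Proof.
move=> d0; apply: floor_def; have dR : 0 < d%:R :> R by rewrite ltr0n.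
have -> : ((n %/ d)%N%:Z + 1)%:~R = (n %/ d).+1%:R :> R by rewrite -natr1 intrD.
rewrite ler_pdivlMr // ltr_pdivrMr // -!natrM ler_nat ltr_nat.
by rewrite leq_divM ltn_ceil.
Qed.

Lemma sum_set_sign (T : finType) (F : T -> R) :
  \sum_(S : {set T}) (-1) ^+ #|S| * \prod_(j in S) F j = \prod_j (1 - F j).
Proof.
under [RHS]eq_bigr do rewrite addrC.
rewrite bigA_distr; apply: eq_bigr => S _.
by rewrite -prodrN big_mkcond.
Qed.

(* Inclusion-exclusion over the squarefree divisors of [c]. *)
Lemma Ec_count (c p : nat) : (0 < c)%N -> (0 < p)%N ->
  Ec c p%:R = \sum_(1 <= m < (c %/ p).+1) (coprime m c)%:R.
Proof.
move=> c0 p0; rewrite /Ec.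
transitivity (\sum_(S : {set 'I_(size (primes c))}) \sum_(1 <= m < (c %/ p).+1)
    ((-1) ^+ #|S| * \prod_(j in S) (qc c j %| m)%N%:R : R)).
  apply: eq_bigr => S _; rewrite -mulr_sumr -natrM floor_natr_div; last first.
    by rewrite muln_gt0 p0 prodn_gt0 // => j; rewrite prime_gt0 ?qc_prime.
  (* With d the product over [S], the floor of c/(pd) counts the multiples of d up to [c %/ p]; the
     sum over [S] can then be done for each [m] separately. *)
  rewrite divnMA divn_count_dvd -pmulrn natr_sum; congr (_ * _).
  by apply: eq_bigr => m _; rewrite dvdn_prod_qc.
rewrite exchange_big /= big_nat [RHS]big_nat; apply: eq_bigr => m /andP[m0 _].
by rewrite sum_set_sign indicator_coprime.
Qed.

(** * Euler's product for the totient and the lower bound for [Ec] *)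

Lemma natr_prod_primes (c : nat) : (0 < c)%N ->
  c%:R = \prod_(q <- primes c) q%:R ^+ logn q c :> R.
Proof.
move=> c0; rewrite [in LHS](prod_prime_decomp c0) prime_decompE big_map /=.
by rewrite natr_prod; apply: eq_bigr => q _; rewrite natrX.
Qed.

Lemma totient_prod (c : nat) : (0 < c)%N ->
  (totient c)%:R = c%:R * \prod_(j < size (primes c)) (1 - (qc c j)%:R^-1) :> R.
Proof.
move=> c0; rewrite -(big_primes_qc _ _ _ c (fun q => 1 - q%:R^-1)).
rewrite (natr_prod_primes _ c0) totientE // natr_prod -big_split /=; apply: eq_big_seq => q.
rewrite mem_primes => /and3P[pq _ qc]; have q0 := prime_gt0 pq.
have : (0 < logn q c)%N by rewrite logn_gt0 mem_primes pq c0.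
case: (logn q c) => // a _; rewrite natrM !natrX exprSr -mulrA mulrC; congr (_ * _).
by rewrite mulrBr mulr1 divff ?pnatr_eq0 -?lt0n // -subn1 natrB.
Qed.

Lemma Ec_ge (c p : nat) : (0 < c)%N -> (0 < p)%N ->
  (totient c)%:R / p%:R - 2 ^+ size (primes c) <= Ec c p%:R.
Proof.
move=> c0 p0.
(* Written as a sum of ones over the subsets, the error term allows one unit per floor, enough for
   either sign. *)
have -> : (2 : R) ^+ size (primes c) = \sum_(S : {set 'I_(size (primes c))}) 1.
  by rewrite sumr_const -cardsT -powersetT card_powerset cardsT card_ord natrX.
rewrite totient_prod // mulrAC -sum_set_sign mulr_sumr -sumrB.
apply: ler_sum => S _.
set x := c%:R / (_ * _).
have -> : c%:R / p%:R * ((-1) ^+ #|S| * \prod_(j in S) (qc c j)%:R^-1) = (-1) ^+ #|S| * x.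
  by rewrite mulrCA /x natr_prod prodfV invfM !mulrA.
have := floor_itv x; rewrite intrD -signr_odd => /andP[].
by case: (odd _); rewrite ?expr0 ?expr1; lra.
Qed.

(** * Logarithmic estimates of Chebyshev and Mertens *)

Lemma ln_prod (I : Type) (s : seq I) (P : pred I) (F : I -> R) :
  (forall i, P i -> 0 < F i) ->
  ln (\prod_(i <- s | P i) F i) = \sum_(i <- s | P i) ln (F i).
Proof.
move=> F0; elim: s => [|i s IHs]; first by rewrite !big_nil ln1.
rewrite !big_cons; case: ifP => // Pi.
by rewrite lnM ?IHs // posrE ?F0 ?prodr_gt0.
Qed.

Lemma ln_nat_ge0 (n : nat) : 0 <= ln (n%:R : R).
Proof. by case: n => [|n]; [rewrite ln0 | rewrite ln_ge0 // ler1n]. Qed.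

Lemma ln_natS_le (n : nat) : (0 < n)%N ->
  n%:R * (ln (n.+1%:R : R) - ln n%:R) <= 1.
Proof.
move=> n0; have nR : 0 < n%:R :> R by rewrite ltr0n.
rewrite -ln_div ?posrE ?ltr0n // mulrC -ler_pdivlMr // div1r.
have -> : n.+1%:R / n%:R = 1 + n%:R^-1 :> R.
  by rewrite -natr1 mulrDl divff ?gt_eqF // mul1r.
by apply: le_ln1Dx; apply: lt_le_trans (ltrN10 _) _; rewrite invr_ge0 ltW.
Qed.

Lemma theta_le (n : nat) :
  \sum_(1 <= p < n.+1 | prime p) ln (p%:R : R) <= n%:R * ln 4.
Proof.
rewrite -ln_prod => [|p /prime_gt0]; last by rewrite ltr0n.
rewrite mulrC mulr_natr -lnXn // ler_ln ?posrE ?exprn_gt0 //; last first.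
  by rewrite prodr_gt0 // => p /prime_gt0; rewrite ltr0n.
by rewrite -natr_prod -natrX ler_nat primorial_le.
Qed.

(** A weak Stirling bound; the induction step is [ln_natS_le], that is, ln(1 + 1/n) is at most
    1/n. *)
Lemma ln_fact_ge (n : nat) : n%:R * ln n%:R - n%:R <= ln (n`!%:R : R).
Proof.
elim: n => [|n IHn]; first by rewrite mul0r subr0 ln_nat_ge0.
rewrite factS natrM lnM ?posrE ?ltr0n ?fact_gt0 //.
have [->|n0] := posnP n; first by rewrite fact0 !ln1 mulr0; lra.
by have := ln_natS_le n n0; rewrite -natr1; lra.
Qed.

(** The primes run up to a fixed [m] rather than [k], so the induction on [k] keeps one index
    range. *)
Lemma ln_fact_logn (m k : nat) : (k <= m)%N ->
  ln (k`!%:R : R) = \sum_(1 <= p < m.+1 | prime p) (logn p k`!)%:R * ln p%:R.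
Proof.
elim: k => [_|k IHk ltkm].
  by rewrite fact0 ln1 big1 // => p _; rewrite logn1 mul0r.
rewrite factS natrM lnM ?posrE ?ltr0n ?fact_gt0 // IHk 1?ltnW //.
transitivity (\sum_(1 <= p < m.+1 | prime p)
    ((logn p k.+1)%:R * ln p%:R + (logn p k`!)%:R * ln p%:R : R)); last first.
  by apply: eq_bigr => p _; rewrite lognM ?fact_gt0 // natrD mulrDl.
rewrite big_split /=; congr (_ + _).
rewrite -[in LHS](@partnT k.+1) // (@widen_partn m) // natr_prod ln_prod; last first.
  move=> p _; rewrite ltr0n expn_gt0 lognE.
  by case: p => //; rewrite orbT.
(* The product from [widen_partn] starts at index 0, whose factor is 0^0 = 1; non-primes have
   exponent 0. *)
rewrite [LHS]big_ltn_cond // lognE /= expn0 ln1 add0r.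
rewrite big_mkcond [RHS]big_mkcond /= big_nat [RHS]big_nat.
apply: eq_bigr => p /andP[p0 _]; rewrite natrX lnXn ?ltr0n // mulr_natl.
by case: ifP => //; rewrite lognE => ->; rewrite mulr0n.
Qed.

(* The series telescopes: its k-th term is at most the increment of
   [- (ln k + 2) / k] from [k - 1] to [k], and vanishes for [k = 1]. *)
Lemma sum_ln_pred_le (n : nat) :
  \sum_(1 <= k < n.+2) ln k%:R / (k%:R * k.-1%:R) <= 2 - (ln n.+1%:R + 2) / n.+1%:R :> R.
Proof.
elim: n => [|n IHn]; first by rewrite big_nat1 ln1 mul0r divr1; lra.
rewrite big_nat_recr //=; apply: le_trans (lerD IHn (lexx _)) _.
have := ln_natS_le n.+1 isT.
set a := ln n.+2%:R; set b := ln n.+1%:R.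
rewrite -[n.+2%:R]natr1; set x : R := n.+1%:R => h.
have x1 : 1 <= x by rewrite ler1n.
have ab : b <= a by rewrite ler_ln ?posrE ?ltr0n // ler_nat.
clearbody a b x.
have x0 : 0 < x by lra.
have y0 : 0 < x + 1 by lra.
rewrite -subr_ge0.
have -> : 2 - (a + 2) / (x + 1) - (2 - (b + 2) / x + a / ((x + 1) * x)) =
  ((b - a) * (x + 1) + 2) / ((x + 1) * x).
  by field; rewrite !gt_eqF.
apply: divr_ge0; last by apply: mulr_ge0; apply: ltW.
(* As x >= 1, [h] gives a - b <= x(a - b) <= 1, hence (a - b)(x + 1) <= 2. *)
nra.
Qed.

(** Compare [ln_fact_ge] with the upper bound for [ln n!] given by [logn_fact_le], splitting 1/(p-1)
    as 1/p + 1/(p(p-1)). The constant 3 is 1 from the Stirling bound plus 2 from the convergent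
    tail. *)
Lemma mertens_ge (n : nat) : (0 < n)%N ->
  ln n%:R - 3 <= \sum_(1 <= p < n.+1 | prime p) ln p%:R / p%:R :> R.
Proof.
move=> n0; have nR : 0 < n%:R :> R by rewrite ltr0n.
have tail : \sum_(1 <= p < n.+1 | prime p) ln p%:R / (p%:R * p.-1%:R) <= 2 :> R.
  apply: (@le_trans _ _ (\sum_(1 <= k < n.+1) ln k%:R / (k%:R * k.-1%:R))).
    rewrite big_mkcond; apply: ler_sum => p _; case: ifP => // _.
    by rewrite divr_ge0 ?mulr_ge0 ?ln_nat_ge0.
  case: n n0 {nR} => // n _; apply: le_trans (sum_ln_pred_le n) _.
  by rewrite gerBl divr_ge0 ?addr_ge0 ?ln_nat_ge0.
have : ln (n`!%:R : R) <= n%:R * (\sum_(1 <= p < n.+1 | prime p) ln p%:R / p%:R +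
    \sum_(1 <= p < n.+1 | prime p) ln p%:R / (p%:R * p.-1%:R)).
  rewrite (ln_fact_logn n) // -big_split mulr_sumr /=; apply: ler_sum => p pp.
  have p1 : 0 < p.-1%:R :> R by rewrite ltr0n -subn1 subn_gt0 prime_gt1.
  have pE : p%:R = p.-1%:R + 1 :> R by rewrite natr1 prednK ?prime_gt0.
  have -> : ln p%:R / p%:R + ln p%:R / (p%:R * p.-1%:R) = ln p%:R / p.-1%:R :> R.
    by rewrite pE; field; rewrite -pE (gt_eqF p1) gt_eqF // ltr0n prime_gt0.
  rewrite mulrCA mulrC ler_wpM2l ?ln_nat_ge0 // ler_pdivlMr // mulrC.
  by rewrite -natrM ler_nat logn_fact_le.
move/(le_trans (ln_fact_ge n)) => h; rewrite -(ler_pM2l nR).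
have := ler_wpM2l (ltW nR) tail; move: h; rewrite mulrDr; lra.
Qed.

(** * Radicals and the logarithm of [Gc] *)

Lemma rad_mul (m n : nat) : (0 < m)%N -> (0 < n)%N -> coprime m n ->
  (Defs.rad (m * n) = Defs.rad m * Defs.rad n)%N.
Proof.
move=> m0 n0 cmn; rewrite /Defs.rad -big_cat; apply: perm_big; apply: uniq_perm.
- exact: primes_uniq.
- by rewrite cat_uniq !primes_uniq andbT /= -coprime_has_primes.
- by move=> p; rewrite mem_cat primesM.
Qed.

Lemma rad_gt0 (n : nat) : (0 < Defs.rad n)%N.
Proof.
rewrite /Defs.rad big_seq prodn_cond_gt0 // => p.
by rewrite mem_primes => /and3P[/prime_gt0].
Qed.

(** A range independent of [n] lets the sums over integers and over primes be exchanged. *)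
Lemma sum_primes_range (F : nat -> R) (n m : nat) : (0 < n)%N -> (n <= m)%N ->
  \sum_(p <- primes n) F p = \sum_(1 <= p < m.+1 | prime p) (p %| n)%N%:R * F p.
Proof.
move=> n0 lenm.
rewrite [RHS](eq_bigr (fun p => if (p %| n)%N then F p else 0)); last first.
  by move=> p _; case: ifP; rewrite ?mul1r ?mul0r.
rewrite -big_mkcondr -[RHS]big_filter; apply: perm_big; apply: uniq_perm.
- exact: primes_uniq.
- by rewrite filter_uniq ?iota_uniq.
move=> p; rewrite mem_filter mem_primes mem_index_iota n0 /=.
case: (boolP (prime p)) => //= pp; case: (boolP (p %| n)%N) => //= pn.
by rewrite prime_gt0 // ltnS (leq_trans (dvdn_leq _ pn)).
Qed.

Lemma ln_rad (n : nat) : ln ((Defs.rad n)%:R : R) = \sum_(p <- primes n) ln p%:R.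
Proof.
rewrite /Defs.rad natr_prod big_seq [RHS]big_seq ln_prod // => p.
by rewrite mem_primes ltr0n => /and3P[/prime_gt0].
Qed.

Lemma coprime_subr_lt (a c : nat) : (a < c)%N -> coprime a (c - a) = coprime a c.
Proof. by move=> ac; rewrite /coprime -gcdnDr subnK // ltnW. Qed.

(** The reflection of [a] to [c - a] preserves coprimality to [c] and exchanges the two halves of
    the range. *)
Lemma sum_coprime_halves (F : nat -> R) (c : nat) : (2 < c)%N ->
  \sum_(1 <= a < c | coprime a c) F a =
  \sum_(1 <= a < c | ((a < c - a) && coprime a (c - a))%N) (F a + F (c - a)%N).
Proof.
move=> c2; rewrite big_split /= [X in _ = _ + X]big_mkcond [X in _ = _ + X]big_nat_rev /=.
rewrite -big_mkcond /= [LHS](bigID (fun a => a < c - a)%N) /=; congr (_ + _).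
  by apply: congr_big_nat => // a /andP[a0 ac]; rewrite coprime_subr_lt // andbC.
rewrite big_mkcond [RHS]big_mkcond !big_nat; apply: eq_bigr => a /andP[a0 ac].
have -> : (1 + c - a.+1 = c - a)%N by lia.
have -> : (c - (c - a) = a)%N by lia.
rewrite [coprime (c - a)%N _]coprime_sym -(coprime_subr_lt _ _ ac).
have [lt|gt|e] := ltngtP a (c - a)%N; rewrite ?andbF ?andbT //=.
(* A midpoint coprime to [c] would have to be 1, forcing [c] = 2. *)
by rewrite -e /coprime gcdnn; case: eqP => //; lia.
Qed.

(** A prime dividing [c] divides no [n] coprime to [c]. Any other prime [p] divides those [n] =
    [p * m] with [m] coprime to [c], and [Ec_count] counts these [m]. *)
Lemma sum_coprime_rad (c : nat) : (2 < c)%N ->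
  \sum_(1 <= n < c | coprime n c) ln ((Defs.rad n)%:R : R) =
  \sum_(1 <= p < c.+1 | prime p) (~~ (p %| c)%N)%:R * (Ec c p%:R * ln p%:R).
Proof.
move=> c2; have c0 : (0 < c)%N by apply: leq_trans c2.
rewrite big_nat_cond (eq_bigr (fun n => \sum_(1 <= p < c.+1 | prime p)
    (p %| n)%N%:R * ln p%:R)); last first.
  by move=> n /andP[/andP[n0 nc] _]; rewrite ln_rad (sum_primes_range _ n c) // ltnW.
rewrite -big_nat_cond exchange_big /=; apply: eq_bigr => p pp; have p0 := prime_gt0 pp.
rewrite -mulr_suml mulrA; congr (_ * _).
case: (boolP (p %| c)%N) => pc /=.
  rewrite mul0r big1 // => n cnc; case: (boolP (p %| n)%N) => // pn.
  by have := coprime_dvdl pn cnc; rewrite prime_coprime // pc.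
rewrite mul1r Ec_count // -!natr_sum; congr (_%:R).
rewrite [RHS](eq_bigr (fun m => coprime (p * m)%N c : nat)); last first.
  by move=> m _; rewrite coprimeMl (prime_coprime _ pp) pc.
rewrite -(sum_nat_dvdn (fun n => coprime n c : nat)) //.
(* The range may stop before [c], since [p] does not divide [c]. *)
rewrite [RHS]big_mkcond big_nat_recr //= -big_mkcond /= (negbTE pc) addn0.
rewrite big_mkcond [RHS]big_mkcond; apply: eq_bigr => n _ /=.
by case: (coprime n c); case: (p %| n)%N.
Qed.

Lemma totient_sum (c : nat) : (1 < c)%N ->
  (totient c)%:R = \sum_(1 <= n < c | coprime n c) 1 :> R.
Proof.
move=> c1; rewrite totient_count_coprime big_ltn ?(ltnW c1) //.
rewrite /coprime gcdn0 gtn_eqF // add0n natr_sum [RHS]big_mkcond.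
by apply: eq_bigr => n _; rewrite gcdnC; case: eqP.
Qed.

(** [a], [c - a] and [c] are pairwise coprime, so each radical splits in three. The sum over primes
    not dividing [c] is written as a difference so that [sum_Ec_ge] applies to the full sum. *)
Lemma ln_Gc (c : nat) : (2 < c)%N ->
  ln ((Gc c)%:R : R) = (totient c)%:R / 2 * \sum_(q <- primes c) ln q%:R
    + (\sum_(1 <= p < c.+1 | prime p) Ec c p%:R * ln p%:R
       - \sum_(q <- primes c) Ec c q%:R * ln q%:R).
Proof.
move=> c2; have c0 : (0 < c)%N by apply: leq_trans c2.
rewrite /Gc natr_prod ln_prod => [|a _]; last by rewrite ltr0n rad_gt0.
have -> : \sum_(1 <= p < c.+1 | prime p) Ec c p%:R * ln p%:R
    - \sum_(q <- primes c) Ec c q%:R * ln q%:R =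
    \sum_(1 <= p < c.+1 | prime p) (~~ (p %| c)%N)%:R * (Ec c p%:R * ln p%:R).
  rewrite (sum_primes_range (fun q => Ec c q%:R * ln q%:R) c c) // -sumrB.
  apply: eq_bigr => p _.
  by case: (p %| c)%N; rewrite /= ?mul1r ?mul0r ?subrr ?subr0.
(* The totient becomes a sum of 1 + 1 over the pairs, so both sides can be compared pair by pair. *)
rewrite -sum_coprime_rad // totient_sum ?(ltnW c2) // !sum_coprime_halves //.
rewrite -ln_rad; set L := ln (Defs.rad c)%:R.
rewrite !mulr_suml -big_split /= big_nat_cond [RHS]big_nat_cond.
apply: eq_bigr => a /and3P[/andP[a0 ac] _ co].
have ca0 : (0 < c - a)%N by rewrite subn_gt0.
have coac : coprime (a * (c - a))%N c.
  have := co; rewrite coprime_subr_lt // coprimeMl => ->.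
  by rewrite /coprime -{2}(subnK (ltnW ac)) gcdnDl gcdnC.
rewrite !rad_mul ?muln_gt0 ?a0 //.
rewrite !natrM !lnM ?posrE ?mulr_gt0 ?ltr0n ?rad_gt0 // -/L; lra.
Qed.

(** * The lower bound for the sum of [Ec c p * ln p] *)

Lemma Ec_ge0 (c p : nat) : (0 < c)%N -> (0 < p)%N -> 0 <= Ec c p%:R.
Proof. by move=> c0 p0; rewrite Ec_count // sumr_ge0. Qed.

Lemma sum_Ec_ge (c : nat) : (0 < c)%N ->
  (totient c)%:R * (ln (totient c)%:R - (size (primes c))%:R * ln 2 - 9)
  <= \sum_(1 <= p < c.+1 | prime p) Ec c p%:R * ln p%:R :> R.
Proof.
move=> c0; set phi : R := (totient c)%:R; set w := size (primes c).
have phi0 : 0 < phi by rewrite ltr0n totient_gt0.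
have ln2_ge0 : 0 <= ln (2 : R) by rewrite ln_ge0 // ler1n.
have ln2_lt2 := ln_sublinear (ltr0n R 2).
pose n := (totient c %/ 2 ^ w)%N.
have lnw : ln ((2 : R) ^+ w) = w%:R * ln 2 by rewrite lnXn // mulr_natl.
have w0 : 0 < (2 : R) ^+ w by rewrite exprn_gt0.
have term0 p : prime p -> 0 <= Ec c p%:R * ln (p%:R : R).
  by move=> /prime_gt0 p0; rewrite mulr_ge0 ?Ec_ge0 ?ln_nat_ge0.
(* If the cut-off [n] is 0, then [phi < 2 ^+ w] and the left side is negative. *)
have [n0|n0] := posnP n.
  have : phi < 2 ^+ w.
    rewrite -natrX ltr_nat ltnNge; apply/negP => le.
    by have := divn_gt0 (totient c) (expn_gt0 2 w); rewrite -/n n0 le.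
  rewrite -ltr_ln ?posrE // lnw => lt.
  apply: (@le_trans _ _ 0); last exact: sumr_ge0.
  by rewrite pmulr_rle0 //; lra.
have lenc : (n <= c)%N.
  apply: leq_trans (leq_div _ _) _.
  rewrite totient_count_coprime -[leqRHS]subn0 -[leqRHS]muln1 -sum_nat_const_nat.
  by apply: leq_sum => d _; exact: leq_b1.
have nE : n%:R * 2 ^+ w <= phi by rewrite -natrX -natrM ler_nat leq_divM.
(* Rounding in [n] costs at most a factor 2, because [n.+1] is at most [2n]. *)
have nlt : ln phi - w%:R * ln 2 - ln 2 <= ln n%:R.
  have : phi <= n%:R * 2 * 2 ^+ w.
    rewrite -natrX -!natrM ler_nat.
    have := ltn_ceil (totient c) (expn_gt0 2 w); rewrite -/n => /ltnW /leq_trans; apply.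
    by rewrite leq_mul2r; apply/orP; right; lia.
  have nR : 0 < n%:R :> R by rewrite ltr0n.
  have m0 : 0 < n%:R * 2 * 2 ^+ w :> R by rewrite !mulr_gt0.
  move=> le; have : ln phi <= ln (n%:R * 2 * 2 ^+ w) by rewrite ler_ln.
  by rewrite !lnM ?posrE ?mulr_gt0 // lnw; lra.
have trunc : \sum_(1 <= p < n.+1 | prime p) Ec c p%:R * ln p%:R <=
    \sum_(1 <= p < c.+1 | prime p) Ec c p%:R * ln p%:R.
  rewrite [leRHS](big_cat_nat _ (n := n.+1)) //= lerDl.
  exact: sumr_ge0.
apply: le_trans trunc.
have : \sum_(1 <= p < n.+1 | prime p) (phi * (ln p%:R / p%:R) - 2 ^+ w * ln p%:R) <=
    \sum_(1 <= p < n.+1 | prime p) Ec c p%:R * ln p%:R.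
  apply: ler_sum => p /prime_gt0 p0.
  have -> : phi * (ln p%:R / p%:R) - 2 ^+ w * ln p%:R = (phi / p%:R - 2 ^+ w) * ln p%:R.
    by rewrite mulrBl mulrAC mulrA.
  by rewrite ler_wpM2r ?ln_nat_ge0 // Ec_ge.
apply: le_trans; rewrite sumrB -!mulr_sumr.
have ln4 : ln (4 : R) = 2 * ln 2.
  by rewrite -[4]/(2 * 2)%N%:R natrM lnM ?posrE //; lra.
(* The choice of [n] pays here: [n * 2 ^+ w] is at most [phi]. *)
have chebyshev : 2 ^+ w * \sum_(1 <= p < n.+1 | prime p) ln (p%:R : R) <= phi * (2 * ln 2).
  apply: le_trans (ler_wpM2l (ltW w0) (theta_le n)) _.
  by rewrite ln4 [leLHS]mulrA ler_wpM2r ?mulr_ge0 // mulrC.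
(* The total loss per unit of [phi] is 3 (Mertens) + ln 2 (rounding) + 2 ln 2 (Chebyshev), below 9
   by the crude bound ln 2 < 2. *)
have := ler_wpM2l (ltW phi0) (mertens_ge n n0).
have := ler_wpM2l (ltW phi0) nlt; have := ler_wpM2l (ltW phi0) (ltW ln2_lt2).
move: chebyshev; rewrite !mulrBr; lra.
Qed.

(** * Assembling the inequality *)

(** Splitting 1 - 1/q as 2 · ((q-1)/2) / q produces the factors of the final bound; the terms [ln 2]
    cancel the loss [omega ln 2] of [sum_Ec_ge]. *)
Lemma ln_totient (c : nat) : (0 < c)%N ->
  ln (totient c)%:R =
  ln c%:R + \sum_(q <- primes c) (ln ((q%:R - 1) / 2) - ln q%:R + ln 2) :> R.
Proof.
move=> c0; rewrite totient_prod // -(big_primes_qc _ _ _ c (fun q => 1 - q%:R^-1)).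
have q_gt1 q : q \in primes c -> 1 < q%:R :> R.
  by rewrite mem_primes ltr1n => /and3P[/prime_gt1].
rewrite big_seq lnM ?posrE ?ltr0n ?prodr_gt0 //; last first.
  by move=> q /q_gt1 q1; rewrite subr_gt0 invf_lt1 ?(lt_trans ltr01).
congr (_ + _); rewrite ln_prod => [|q /q_gt1 q1]; last first.
  by rewrite subr_gt0 invf_lt1 ?(lt_trans ltr01).
rewrite [RHS]big_seq; apply: eq_bigr => q /q_gt1 q1.
have q0 : 0 < q%:R :> R by apply: lt_trans q1.
have -> : (q%:R - 1) / 2 = q%:R * (1 - q%:R^-1) / 2 :> R.
  by rewrite mulrBr mulr1 divff // gt_eqF.
rewrite ln_div ?lnM ?posrE ?mulr_gt0 ?subr_gt0 ?invf_lt1 //; lra.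
Qed.

Theorem theorem2 :
  exists k4 : R, 0 < k4 /\
    forall c : nat, (3 <= c)%N ->
      k4 * \prod_(q <- primes c)
             ((q%:R : R) `^ ((2 * logn q c)%:R - 1 - 2 / (totient c)%:R * Ec c q%:R)
              * ((q%:R - 1) / 2) ^+ 2)
      < (Gc c)%:R `^ (2 / (totient c)%:R).
Proof.
(* The error 9 is doubled by the exponent [2 / totient c]; 19 instead of 18 makes the inequality
   strict. *)
exists (expR (- 19)); split; first exact: expR_gt0.
move=> c c2; have c0 : (0 < c)%N by apply: leq_trans c2.
have phi0 : 0 < (totient c)%:R :> R by rewrite ltr0n totient_gt0.
have G0 : 0 < (Gc c)%:R :> R.
  by rewrite ltr0n prodn_cond_gt0 // => a _; exact: rad_gt0.
have q_gt1 q : q \in primes c -> 1 < q%:R :> R.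
  by rewrite mem_primes ltr1n => /and3P[/prime_gt1].
have factor0 q : q \in primes c -> 0 < (q%:R : R) `^
    ((2 * logn q c)%:R - 1 - 2 / (totient c)%:R * Ec c q%:R) * ((q%:R - 1) / 2) ^+ 2.
  move=> /q_gt1 q1; rewrite mulr_gt0 ?powR_gt0 ?exprn_gt0 ?divr_gt0 ?subr_gt0 //.
  exact: lt_trans q1.
rewrite -ltr_ln ?posrE ?powR_gt0 ?mulr_gt0 ?expR_gt0 //; last first.
  by rewrite big_seq prodr_gt0.
rewrite lnM ?posrE ?expR_gt0 // ?expRK; last by rewrite big_seq prodr_gt0.
rewrite ln_powR ln_Gc // big_seq ln_prod //.
have := sum_Ec_ge _ c0; have := ln_totient _ c0.
have lnc : ln c%:R = \sum_(q <- primes c) (logn q c)%:R * ln q%:R :> R.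
  rewrite (natr_prod_primes _ c0) big_seq ln_prod => [|q /q_gt1 q1]; last first.
    by rewrite exprn_gt0 // (lt_trans ltr01).
  rewrite [RHS]big_seq; apply: eq_bigr => q /q_gt1 q1.
  by rewrite lnXn ?mulr_natl // (lt_trans ltr01).
rewrite lnc.
have -> : (size (primes c))%:R * ln 2 = \sum_(q <- primes c) ln 2 :> R.
  by rewrite big_const_seq count_predT iter_addr_0 mulr_natl.
rewrite !big_split /= sumrN => lnphi Sge.
set phi := (totient c)%:R in phi0 lnphi Sge *.
have -> : \sum_(q <- primes c | q \in primes c) ln ((q%:R : R) `^
      ((2 * logn q c)%:R - 1 - 2 / phi * Ec c q%:R) * ((q%:R - 1) / 2) ^+ 2) =
    2 * (\sum_(q <- primes c) (logn q c)%:R * ln q%:R) - \sum_(q <- primes c) ln q%:R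
    - 2 / phi * (\sum_(q <- primes c) Ec c q%:R * ln q%:R)
    + 2 * \sum_(q <- primes c) ln ((q%:R - 1) / 2).
  rewrite !mulr_sumr -!sumrB -big_split -big_seq /= big_seq [RHS]big_seq.
  apply: eq_bigr => q /q_gt1 q1; have q0 : 0 < q%:R :> R by apply: lt_trans q1.
  have h0 : 0 < (q%:R - 1) / 2 :> R by rewrite divr_gt0 // subr_gt0.
  rewrite lnM ?posrE ?powR_gt0 ?exprn_gt0 // ln_powR lnXn // natrM -mulr_natl.
  by ring.
set A := \sum_(q <- _) (logn q c)%:R * _ in lnphi *.
set L := \sum_(q <- _) ln q%:R in lnphi *.
set H := \sum_(q <- _) ln (_ / _) in lnphi *.
set W := \sum_(q <- _) ln 2 in lnphi Sge *.
set E := \sum_(q <- _) _ * _.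
set S := \sum_(1 <= p < _ | _) _ in Sge *.
rewrite mulrDr mulrA mulrBr.
have -> : 2 / phi * (phi / 2) = 1 :> R by field; rewrite gt_eqF.
have : ln phi - W - 9 <= phi^-1 * S by rewrite ler_pdivlMl.
rewrite mul1r -!mulrA; lra.
Qed.
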